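(* Let $M^m$ be an $m$-dimensional Riemannian manifold, let $F:M^m\to\mathbb{R}^{n+k+1}$ be an isometric immersion, and let $E_1,\ldots,E_{n+k+1}$ be a parallel orthonormal frame of $\mathbb{R}^{n+k+1}$ such that \[ \Delta F=-c\left(m-\sum_{j=n+2}^{n+k+1}\|T_j\|^2\right)\left(F-\sum_{j=n+2}^{n+k+1}\langle F,E_j\rangle E_j\right) \] for some constant $c\neq 0$, where $T_j$ denotes the orthogonal projection of $E_j$ onto the tangent bundle $TM$. Then $c>0$ and there exists a minimal isometric immersion $f:M^m\to\mathbb{S}^n_c\times\mathbb{R}^k$ such that $F=i\circ f$, where $i:\mathbb{S}^n_c\times\mathbb{R}^k\to\mathbb{R}^{n+k+1}$ is the canonical isometric embedding, the factors being taken with respect to the splitting $\mathbb{R}^{n+k+1}=\mathbb{R}^{n+1}\oplus\mathbb{R}^k$ with $\mathbb{R}^{n+1}=\mathrm{span}\{E_1,\ldots,E_{n+1}\}$ and $\mathbb{R}^k=\mathrm{span}\{E_{n+2},\ldots,E_{n+k+1}\}$.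
   Context: A parallel orthonormal frame of Euclidean space is a constant orthonormal basis. The Laplacian of a smooth function $h$ on $M$ is $\Delta h=\mathrm{trace}\,\mathrm{Hess}\,h=\mathrm{div}\,\mathrm{grad}\,h$, and for a map $F=(F_1,\ldots,F_N):M\to\mathbb{R}^N$ one sets $\Delta F=(\Delta F_1,\ldots,\Delta F_N)$. The orthogonal projection $T_j$ of $E_j$ onto $TM$ is the tangent vector field on $M$ such that $F_*T_j$ is the component of $E_j$ (along $F$) tangent to $F$. An isometric immersion is minimal if its mean curvature vector field vanishes identically. For $c>0$, $\mathbb{S}^n_c=\{X\in\mathbb{R}^{n+1}:\langle X,X\rangle=1/c\}$ is the $n$-sphere of constant sectional curvature $c$, and $\mathbb{S}^n_c\times\mathbb{R}^k\subset\mathbb{R}^{n+1}\times\mathbb{R}^k=\mathbb{R}^{n+k+1}$ is the Riemannian product with its canonical isometric embedding $i$.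
   Formalization: Added hypothesis: m − Σ‖T_j‖² is not identically zero on any connected component of M; without it the claim fails, e.g. F(t) = (0,t) with n = 0, k = m = 1 satisfies the equation for c = −1. *)

(* Defs.v *)
From HB Require Import structures.
From mathcomp Require Import all_boot all_order all_algebra.
From mathcomp Require Import all_classical all_reals all_analysis.
Set Implicit Arguments.
Unset Strict Implicit.
Unset Printing Implicit Defensive.
Import Order.TTheory GRing.Theory Num.Theory.
Import numFieldNormedType.Exports.
Local Open Scope classical_set_scope.
Local Open Scope ring_scope.

Definition dot (R : realType) (N : nat) (u v : 'rV[R]_N) : R :=
  \sum_(i < N) u 0 i * v 0 i.

Definition partial (R : realType) (m : nat) (a : 'I_m) (u : 'rV[R]_m -> R) :
    'rV[R]_m -> R :=
  'D_(delta_mx 0 a) u.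

(* C^oo on an open set U: all iterated partial derivatives exist and are
   continuous at the points of U. *)
Definition smooth_on (R : realType) (m : nat) (U : set 'rV[R]_m)
    (u : 'rV[R]_m -> R) : Prop :=
  forall (s : seq 'I_m) (x : 'rV[R]_m), U x ->
    {for x, continuous (foldr (@partial R m) u s)} /\
    forall a : 'I_m, derivable (foldr (@partial R m) u s) x (delta_mx 0 a).

(* A homeomorphism between open sets; chart_map and chart_inv are total
   functions whose values outside chart_dom and its image are irrelevant. *)
Record chart (R : realType) (m : nat) (M : topologicalType) := Chart {
  chart_dom : set M;
  chart_map :> M -> 'rV[R]_m;
  chart_inv : 'rV[R]_m -> M;
  chart_dom_open : open chart_dom;
  chart_img_open : open (chart_map @` chart_dom);
  chart_mapK : forall p, chart_dom p -> chart_inv (chart_map p) = p;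
  chart_map_continuous :
    forall p, chart_dom p -> {for p, continuous chart_map};
  chart_inv_continuous :
    forall x, (chart_map @` chart_dom) x -> {for x, continuous chart_inv} }.

Definition smooth_in_chart (R : realType) (m : nat) (M : topologicalType)
    (phi : chart R m M) (A : set M) (h : M -> R) : Prop :=
  smooth_on (phi @` (chart_dom phi `&` A)) (h \o chart_inv phi).

(* The function d h / d x^a on chart_dom phi, where x = phi. *)
Definition cpartial (R : realType) (m : nat) (M : topologicalType)
    (phi : chart R m M) (a : 'I_m) (h : M -> R) : M -> R :=
  fun p => partial a (h \o chart_inv phi) (phi p).

(* The matrix (d y^b / d x^a)_(a, b) for x = phi and y = psi. *)
Definition transition_jacobian (R : realType) (m : nat) (M : topologicalType)
    (phi psi : chart R m M) (p : M) : 'M[R]_m :=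
  \matrix_(a, b) cpartial phi a (fun q => psi q 0 b) p.

(* metric i p is the Gram matrix g_ab of the metric at p in the i-th chart;
   metric_change says that these matrices represent one (0,2)-tensor field. *)
Record riemannianManifold (R : realType) (m : nat) := RiemannianManifold {
  carrier :> topologicalType;
  manifold_nonempty : [set: carrier] !=set0;
  manifold_hausdorff : hausdorff_space carrier;
  manifold_second_countable : @second_countable carrier;
  chart_index : Type;
  atlas : chart_index -> chart R m carrier;
  atlas_cover : forall p, exists i, chart_dom (atlas i) p;
  atlas_compatible : forall i j (b : 'I_m),
    smooth_in_chart (atlas i) (chart_dom (atlas j))
      (fun p => atlas j p 0 b);
  metric : chart_index -> carrier -> 'M[R]_m;
  metric_sym : forall i p, chart_dom (atlas i) p ->
    (metric i p)^T = metric i p;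
  metric_posdef : forall i p, chart_dom (atlas i) p ->
    forall v : 'rV[R]_m, v != 0 -> 0 < (v *m metric i p *m v^T) 0 0;
  metric_smooth : forall i (a b : 'I_m),
    smooth_in_chart (atlas i) setT (fun p => metric i p a b);
  metric_change : forall i j p,
    chart_dom (atlas i) p -> chart_dom (atlas j) p ->
    let J := transition_jacobian (atlas i) (atlas j) p in
    metric i p = J *m metric j p *m J^T }.

(* A tangent vector field, given by its components in each chart. *)
Record vectorField (R : realType) (m : nat) (M : riemannianManifold R m) :=
  VectorField {
  field_comp :> chart_index M -> M -> 'rV[R]_m;
  field_change : forall i j p,
    chart_dom (atlas i) p -> chart_dom (atlas j) p ->
    field_comp j p =
      field_comp i p *m transition_jacobian (atlas i) (atlas j) p }.

Section RiemannianGeometry.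
Variables (R : realType) (m : nat) (M : riemannianManifold R m).
Implicit Types (i : chart_index M) (p : M) (a b d e : 'I_m).

Definition field_normsq (X : vectorField M) i p : R :=
  (X i p *m metric i p *m (X i p)^T) 0 0.

Definition inv_metric i p : 'M[R]_m := invmx (metric i p).

(* Gamma^e_ab of the Levi-Civita connection. *)
Definition christoffel i e a b p : R :=
  2^-1 * \sum_(d < m) inv_metric i p e d *
    (cpartial (atlas i) a (fun q => metric i q b d) p
     + cpartial (atlas i) b (fun q => metric i q a d) p
     - cpartial (atlas i) d (fun q => metric i q a b) p).

Definition hessian i (h : M -> R) p : 'M[R]_m :=
  \matrix_(a, b) (cpartial (atlas i) a (cpartial (atlas i) b h) p
    - \sum_(e < m) christoffel i e a b p * cpartial (atlas i) e h p).

Definition laplacian i (h : M -> R) p : R :=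
  \sum_(a < m) \sum_(b < m) inv_metric i p a b * hessian i h p a b.

Section Maps.
Variables (N : nat) (F : M -> 'rV[R]_N).

Definition vlaplacian i p : 'rV[R]_N :=
  \row_s laplacian i (fun q => F q 0 s) p.

Definition vpartial i a p : 'rV[R]_N :=
  \row_s cpartial (atlas i) a (fun q => F q 0 s) p.

Definition vpartial2 i a b p : 'rV[R]_N :=
  \row_s cpartial (atlas i) a (cpartial (atlas i) b (fun q => F q 0 s)) p.

(* F_* v, for v given by its components in the i-th chart. *)
Definition tangent_map i p (v : 'rV[R]_m) : 'rV[R]_N :=
  \sum_(a < m) v 0 a *: vpartial i a p.

(* Injectivity of the differential is implied by metric_posdef. *)
Definition isometric_immersion : Prop :=
  (forall i (s : 'I_N), smooth_in_chart (atlas i) setT (fun p => F p 0 s)) /\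
  (forall i p, chart_dom (atlas i) p -> forall v w : 'rV[R]_m,
     dot (tangent_map i p v) (tangent_map i p w)
     = (v *m metric i p *m w^T) 0 0).

(* F_* T is the component of the constant vector field V tangent to F. *)
Definition is_tangent_projection (V : 'rV[R]_N) (T : vectorField M) : Prop :=
  forall i p, chart_dom (atlas i) p -> forall w : 'rV[R]_m,
    dot (V - tangent_map i p (T i p)) (tangent_map i p w) = 0.

End Maps.

End RiemannianGeometry.

Section SphereProduct.
Variables (R : realType) (n k : nat) (c : R).

Definition sphere : set 'rV[R]_n.+1 := [set x | dot x x = c^-1].

(* S^n_c x R^k as a subset of R^(n+1) x R^k = R^(n+1+k). *)
Definition sphere_prod : set 'rV[R]_(n.+1 + k) :=
  [set X | sphere (lsubmx X)].

(* The tangent space T_x S^n_c (+) R^k at X = (x, y). *)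
Definition sphere_prod_tangent (X : 'rV[R]_(n.+1 + k)) :
    set 'rV[R]_(n.+1 + k) :=
  [set V | dot (lsubmx X) (lsubmx V) = 0].

(* Orthogonal projection of R^(n+1+k) onto that space, for X in S^n_c x R^k;
   see sphere_prod_projP. *)
Definition sphere_prod_proj (X V : 'rV[R]_(n.+1 + k)) : 'rV[R]_(n.+1 + k) :=
  V - (c * dot (lsubmx X) (lsubmx V)) *: row_mx (lsubmx X) 0.

Lemma sphere_prod_projP (X V : 'rV[R]_(n.+1 + k)) : c != 0 -> sphere_prod X ->
  sphere_prod_tangent X (sphere_prod_proj X V) /\
  forall W, sphere_prod_tangent X W -> dot (V - sphere_prod_proj X V) W = 0.
Proof.
move=> c0 XS; split=> [|W].
  rewrite /sphere_prod_tangent /sphere_prod_proj /=.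
  set t := c * _.
  have -> : dot (lsubmx X) (lsubmx (V - t *: row_mx (lsubmx X) 0))
            = dot (lsubmx X) (lsubmx V) - t * dot (lsubmx X) (lsubmx X).
    rewrite linearB linearZ /= row_mxKl /dot mulr_sumr -sumrB.
    by apply: eq_bigr => s _; rewrite !mxE mulrBr mulrCA.
  by rewrite XS /t mulrAC mulfV// mul1r subrr.
rewrite /sphere_prod_tangent /sphere_prod_proj /= => XW.
rewrite opprB addrC subrK; set t := c * _.
rewrite /dot big_split_ord /= [X in _ + X]big1 ?addr0 => [|s _]; last first.
  by rewrite [X in X * _]mxE row_mxEr [X in t * X]mxE mulr0 mul0r.
under eq_bigr => s _ do rewrite [X in X * _]mxE row_mxEl -mulrA.
rewrite -mulr_sumr.
suff -> : \sum_(s < n.+1) lsubmx X 0 s * W 0 (lshift k s) = 0.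
  by rewrite mulr0.
by rewrite -[RHS]XW; apply: eq_bigr => s _; rewrite [lsubmx W 0 s]mxE.
Qed.

Variables (m : nat) (M : riemannianManifold R m).
Variable f : M -> 'rV[R]_(n.+1 + k).

(* For f with values in S^n_c x R^k, by the Gauss formula
     alpha(X, Y) = nabla~_X f_* Y - f_* nabla_X Y
   for X = d/dx^a and Y = d/dx^b.  The Levi-Civita connection nabla~ of the
   submanifold S^n_c x R^k is the tangential part of the flat derivative. *)
Definition second_fundamental_form (i : chart_index M) (a b : 'I_m) (p : M) :
    'rV[R]_(n.+1 + k) :=
  sphere_prod_proj (f p) (vpartial2 f i a b p)
  - \sum_(e < m) christoffel i e a b p *: vpartial f i e p.

Definition mean_curvature (i : chart_index M) (p : M) : 'rV[R]_(n.+1 + k) :=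
  m%:R^-1 *: \sum_(a < m) \sum_(b < m)
    inv_metric i p a b *: second_fundamental_form i a b p.

(* Smoothness and the metric of the embedded submanifold S^n_c x R^k are
   inherited from R^(n+1+k). *)
Definition minimal_isometric_immersion : Prop :=
  [/\ forall p, sphere_prod (f p),
      isometric_immersion f
    & forall i p, chart_dom (atlas i) p -> mean_curvature i p = 0].

End SphereProduct.

Definition orthonormal_frame (R : realType) (N : nat)
    (E : 'I_N -> 'rV[R]_N) : Prop :=
  forall s t, dot (E s) (E t) = (s == t)%:R.

(* The embedding of R^(n+1) x R^k, hence of S^n_c x R^k, determined by the
   splitting span {E_s, s < n+1} (+) span {E_s, s >= n+1}. *)
Definition frame_embedding (R : realType) (N : nat) (E : 'I_N -> 'rV[R]_N)
    (X : 'rV[R]_N) : 'rV[R]_N :=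
  \sum_(s < N) X 0 s *: E s.

(* Main.v *)
(* In the coordinates of the frame write f = (f_1, f_2) for F and
   lambda = m - sum_j ||T_j||^2.  Since f is isometric, lambda is the trace of
   <d f_1, d f_1>, and by Koszul's formula the Laplacian of f is normal to f.
   Hence lambda <f_1, d f_1> = 0; as lambda = 0 forces d f_1 = 0, this gives
   <f_1, d f_1> = 0 everywhere, so |f_1|^2 is locally constant.  Differentiating
   once more, <f_1, Hess f_1> = - <d f_1, d f_1>, so pairing the equation for
   the Laplacian with f_1 gives lambda (1 - c |f_1|^2) = 0.  Thus
   |f_1|^2 = 1 / c on each component, and the right-hand side of the equation
   is exactly the part of the Laplacian of f normal to S^n_c x R^k. *)
Require Import Defs.
From HB Require Import structures.
From mathcomp Require Import all_boot all_order all_algebra.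
From mathcomp Require Import all_classical all_reals all_analysis.
From mathcomp Require Import ring lra.
Set Implicit Arguments.
Unset Strict Implicit.
Unset Printing Implicit Defensive.
Import Order.TTheory GRing.Theory Num.Theory.
Import numFieldNormedType.Exports.
Local Open Scope classical_set_scope.
Local Open Scope ring_scope.

(** * Mean value arguments along lines and symmetry of mixed derivatives *)

Section DirectionalDerivatives.
Variables (R : realType) (V : normedModType R).
Implicit Types (u : V -> R) (x a b v : V).

Lemma is_derive_line u x v (t : R) : derivable u (x + t *: v) v ->
  is_derive t 1 (fun s : R => u (x + s *: v)) ('D_v u (x + t *: v)).
Proof.
have E : (fun h : R => h^-1 *: (((fun s => u (x + s *: v)) \o shift t) (h *: 1)
            - u (x + t *: v)))
       = (fun h : R => h^-1 *: ((u \o shift (x + t *: v)) (h *: v)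
            - u (x + t *: v))).
  apply/funext => h /=; congr (_ *: (u _ - _)).
  by rewrite [h *: 1]mulr1 scalerDl addrCA.
by move=> du; split; rewrite /derivable /derive E.
Qed.

Lemma MVT_line u x v (r : R) : 0 < r ->
  (forall t, 0 <= t <= r -> derivable u (x + t *: v) v) ->
  exists2 t, 0 < t < r & u (x + r *: v) - u x = r * 'D_v u (x + t *: v).
Proof.
move=> r0 du.
have der t : 0 <= t <= r ->
    is_derive t 1 (fun s : R => u (x + s *: v)) ('D_v u (x + t *: v)).
  by move=> /du; exact: is_derive_line.
have [||t] := @MVT R (fun s => u (x + s *: v))
                 (fun t => 'D_v u (x + t *: v)) 0 r r0.
- by move=> t; rewrite in_itv/= => /andP[t0 tr]; apply: der; rewrite !ltW.
- apply: derivable_within_continuous => t; rewrite in_itv/= => tr.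
  by have [] := der t tr.
- rewrite in_itv/= scale0r addr0 subr0 => tr ->; exists t => //.
  by rewrite mulrC.
Qed.

Lemma derive0_line u x v (r : R) :
  (forall t, `|t| <= `|r| -> derivable u (x + t *: v) v /\
                             'D_v u (x + t *: v) = 0) ->
  u (x + r *: v) = u x.
Proof.
have pos y (s : R) : 0 < s ->
    (forall t, 0 <= t <= s -> derivable u (y + t *: v) v /\
                              'D_v u (y + t *: v) = 0) ->
    u (y + s *: v) = u y.
  move=> s0 H; have [t tr|t /andP[t0 ts] /eqP] := @MVT_line u y v s s0.
    by have [] := H t tr.
  by rewrite (H t _).2 ?mulr0 ?subr_eq0 ?ltW// => /eqP.
(* For [r < 0] the segment is run backwards, from [x + r *: v] over the length [- r]. *)
move=> H; have [r0|r0|->] := ltgtP r 0; last by rewrite scale0r addr0.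
  have := pos (x + r *: v) (- r); rewrite oppr_gt0 -addrA -scalerDl addrN.
  rewrite scale0r addr0 => -> // t /andP[t0 tr].
  rewrite -addrA -scalerDl; apply: H.
  by rewrite !ler0_norm; lra.
by apply: pos => // t /andP[t0 tr]; apply: H; rewrite !ger0_norm //; lra.
Qed.

(** Two mean value theorems: one in direction [a], for the difference of [u] along two parallel
    sides of a parallelogram, then one in direction [b], for ['D_a u]. The left-hand side is
    symmetric in [a] and [b], which is what [derive_comm] exploits. *)
Lemma second_difference u x a b (h : R) : 0 < h ->
  (forall s t, 0 <= s <= h -> 0 <= t <= h ->
     derivable u (x + s *: a + t *: b) a /\
     derivable ('D_a u) (x + s *: a + t *: b) b) ->
  exists s t, [/\ 0 < s < h, 0 < t < h &
    u (x + h *: a + h *: b) - u (x + h *: b) - (u (x + h *: a) - u x)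
    = h * h * 'D_b ('D_a u) (x + s *: a + t *: b)].
Proof.
move=> h0 H.
have h00 : 0 <= (0 : R) <= h by apply/andP; split=> //; exact: ltW.
have hh : 0 <= h <= h by apply/andP; split=> //; exact: ltW.
pose phi (s : R) := u (x + h *: b + s *: a) - u (x + s *: a).
pose dphi (s : R) := 'D_a u (x + h *: b + s *: a) - 'D_a u (x + s *: a).
have der s : 0 <= s <= h -> is_derive s 1 phi (dphi s).
  move=> sh; apply: is_deriveB; apply: is_derive_line.
    by rewrite addrAC; exact: (H _ _ sh hh).1.
  by have := (H _ _ sh h00).1; rewrite scale0r addr0.
have [||s] := @MVT R phi dphi 0 h h0.
- by move=> s; rewrite in_itv/= => /andP[s0 sh]; apply: der; rewrite !ltW.
- apply: derivable_within_continuous => s; rewrite in_itv/= => sh.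
  by have [] := der s sh.
rewrite in_itv/= subr0 => sh; have /andP[s0 sh'] := sh.
rewrite /phi /dphi scale0r !addr0 => E.
have [t th|t th Et] := @MVT_line ('D_a u) (x + s *: a) b h h0.
  by apply: (H _ _ _ th).2; rewrite !ltW.
exists s, t; split => //.
rewrite -mulrA -Et mulrC (addrAC x (s *: a)) -E (addrAC x (h *: a)); ring.
Qed.

(** Near [x] each mixed derivative stays within [e], half the distance of the two values at [x], of
    its own value. But the second difference over a small parallelogram makes them agree at two
    nearby points, a contradiction. *)
Lemma derive_comm u x a b :
  (\forall y \near x, [/\ derivable u y a, derivable u y b,
     derivable ('D_a u) y b & derivable ('D_b u) y a]) ->
  {for x, continuous ('D_b ('D_a u))} ->
  {for x, continuous ('D_a ('D_b u))} ->
  'D_b ('D_a u) x = 'D_a ('D_b u) x.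
Proof.
move=> du cab cba.
have {}cab e : 0 < e ->
    \forall y \near x, `|'D_b ('D_a u) x - 'D_b ('D_a u) y| < e.
  by move=> e0; move/cvgrPdist_lt : cab; exact.
have {}cba e : 0 < e ->
    \forall y \near x, `|'D_a ('D_b u) x - 'D_a ('D_b u) y| < e.
  by move=> e0; move/cvgrPdist_lt : cba; exact.
move: cab cba.
generalize ('D_b ('D_a u) x : R) ('D_a ('D_b u) x : R) => L1 L2 cab cba.
apply/eqP/negP => /negP neq.
pose e := `|L1 - L2| / 2.
have e0 : 0 < e by rewrite divr_gt0// normr_gt0 subr_eq0.
have [d /= d0 dP] := (nbhs_ballP _ _).1
  (filterI du (filterI (cab e e0) (cba e e0))).
(* The parallelogram with sides [h *: a] and [h *: b] must fit in the ball. The summand 1 keeps the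
   denominator positive when [a] and [b] vanish and makes the bound strict. *)
have [h h0 hd] : exists2 h : R, 0 < h & h * `|a| + h * `|b| < d.
  have ab0 : 0 < `|a| + `|b| + 1 by rewrite ltr_wpDl ?addr_ge0.
  exists (d / (`|a| + `|b| + 1)); first by rewrite divr_gt0.
  rewrite -mulrDr mulrAC ltr_pdivrMr// ltr_pM2l//.
  by rewrite ltrDl.
have near_x s t : 0 <= s <= h -> 0 <= t <= h ->
    ball x d (x + s *: a + t *: b).
  move=> /andP[s0 sh] /andP[t0 th]; rewrite -ball_normE /=.
  rewrite -addrA opprD addrA subrr sub0r normrN.
  apply: le_lt_trans (ler_normD _ _) _; rewrite !normrZ !ger0_norm//.
  by apply: le_lt_trans hd; rewrite lerD// ler_wpM2r.
have [|s [t [/andP[s0 sh] /andP[t0 th] E1]]] := @second_difference u x a b h h0.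
  move=> s t sh th.
  by have [[ua _ uab _] _] := dP _ (near_x s t sh th); split; assumption.
have [|t' [s' [/andP[t0' th'] /andP[s0' sh'] E2]]] :=
    @second_difference u x b a h h0.
  move=> t' s' th' sh'; rewrite addrAC.
  by have [[_ ub _ uba] _] := dP _ (near_x s' t' sh' th'); split; assumption.
have [||_ [H1 _]] := dP _ (near_x s t _ _); try by rewrite !ltW.
have [||_ [_ H2]] := dP _ (near_x s' t' _ _); try by rewrite !ltW.
move: E2 H1 H2.
rewrite (addrAC x (t' *: b)) => E2.
(* The two second differences differ only by the order of their terms. *)
have : h * h * 'D_b ('D_a u) (x + s *: a + t *: b)
     = h * h * 'D_a ('D_b u) (x + s' *: a + t' *: b).
  refine (etrans (esym E1) (etrans _ E2)).
  have -> : u (x + h *: a + h *: b) = u (x + h *: b + h *: a).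
    by congr u; exact: addrAC.
  generalize (u (x + h *: b + h *: a)) (u (x + h *: a)) (u (x + h *: b)) (u x).
  by move=> A B C D; ring.
move/(mulfI (mulf_neq0 (lt0r_neq0 h0) (lt0r_neq0 h0))) => ->.
generalize ('D_a ('D_b u) (x + s' *: a + t' *: b) : R) => y H1 H2.
suff : `|L1 - L2| < e + e by rewrite /e -splitr ltxx.
have -> : L1 - L2 = (L1 - y) - (L2 - y) by rewrite opprB addrA subrK.
by rewrite (le_lt_trans (ler_normB _ _))// ltrD.
Qed.

End DirectionalDerivatives.

(** Only derivatives along the axes are at hand, so [y] is reached from [x] by changing one
    coordinate at a time. Balls of ['rV[R]_m] are cubes, so this path stays in [U]. *)
Lemma derive0_locally_cst (R : realType) (m : nat) (U : set 'rV[R]_m)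
    (u : 'rV[R]_m -> R) : open U ->
  (forall y, U y -> forall a : 'I_m,
     derivable u y (delta_mx 0 a) /\ partial a u y = 0) ->
  forall x, U x -> \forall y \near x, u y = u x.
Proof.
move=> Uo du x Ux.
have [d /= d0 dU] := (nbhs_ballP _ _).1 (open_nbhs_nbhs (conj Uo Ux)).
apply/nbhs_ballP; exists d => //= y xy.
pose z j : 'rV[R]_m := \row_i (if (i < j)%N then y 0 i else x 0 i).
have uz j : (j <= m)%N -> u (z j) = u x.
  elim: j => [_|j IH jm].
    by congr u; apply/rowP => i; rewrite mxE ltn0.
  rewrite -(IH (ltnW jm)); pose a := Ordinal jm.
  have -> : z j.+1 = z j + (y 0 a - x 0 a) *: delta_mx 0 a.
    apply/rowP => i; rewrite !mxE eqxx/= ltnS leq_eqVlt -val_eqE/=.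
    have [ij|ij] /= := eqVneq (i : nat) j.
      have -> : i = a by exact: val_inj.
      by rewrite ltnn mulr1 addrC subrK.
    by rewrite mulr0 addr0.
  apply: derive0_line => t ht; apply: du; apply: dU.
  split=> // i' i; rewrite (ord1 i') -ball_normE /= !mxE eqxx/= -val_eqE/=.
  have xyi : `|x 0 i - y 0 i| < d by have := xy.2 0 i; rewrite -ball_normE.
  have [ij|ij] /= := eqVneq (i : nat) j.
    have ia : i = a by exact: val_inj.
    rewrite ij ltnn mulr1 opprD addrA subrr sub0r normrN.
    by rewrite (le_lt_trans ht)// -ia distrC.
  rewrite mulr0 addr0; case: ifP => // _; by rewrite subrr normr0.
rewrite -(uz m (leqnn m)); congr u; apply/rowP => i.
by rewrite mxE ltn_ord.
Qed.

(** Local constancy makes every preimage open. The fibre through [p] is therefore open and closed,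
    and a connected set that meets it lies in it. *)
Lemma locally_cst_component (T : topologicalType) (S : Type) (h : T -> S) :
  (forall p, \forall q \near p, h q = h p) ->
  forall p q, connected_component [set: T] p q -> h q = h p.
Proof.
move=> hl p q pq.
have op (P : set S) : open (h @^-1` P).
  rewrite openE => r Pr; rewrite /interior.
  by apply: filterS (hl r) => s /= ->.
have E : connected_component setT p `&` h @^-1` [set h p]
       = connected_component setT p.
  apply: component_connected.
  - by exists p; split=> //; exact: connected_component_refl.
  - by exists (h @^-1` [set h p]).
  - exists (h @^-1` [set h p]) => //.
    by rewrite -[X in closed X]setCK closedC; exact: (op (~` [set h p])).
by move: pq; rewrite -E => -[].
Qed.

(** * Iterated partial derivatives of smooth functions *)

Section SmoothFunctions.
Variables (R : realType) (m : nat).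
Implicit Types (U : set 'rV[R]_m) (x v : 'rV[R]_m).

Lemma is_derive_dot N (f g : 'I_N -> 'rV[R]_m -> R) x v :
  (forall s, derivable (f s) x v) -> (forall s, derivable (g s) x v) ->
  is_derive x v (fun y => \sum_s f s y * g s y)
    (\sum_s ('D_v (f s) x * g s x + f s x * 'D_v (g s) x)).
Proof.
move=> df dg.
have -> : (fun y => \sum_s f s y * g s y) = \sum_s (f s * g s).
  by apply/funext => y; rewrite fct_sumE.
apply: is_derive_sum => s.
have := is_deriveM (derivableP (df s)) (derivableP (dg s)).
by rewrite addrC [g s x *: _]mulrC.
Qed.

Lemma smooth_on_partial U a (u : 'rV[R]_m -> R) :
  smooth_on U u -> smooth_on U (partial a u).
Proof.
by move=> su s x Ux; have := su (rcons s a) x Ux; rewrite foldr_rcons.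
Qed.

Lemma smooth_on_derivable U u x (a : 'I_m) :
  smooth_on U u -> U x -> derivable u x (delta_mx 0 a).
Proof. by move=> su /(su [::])[_]. Qed.

Lemma eq_partial_on U (u w : 'rV[R]_m -> R) a : open U ->
  {in U, u =1 w} -> {in U, partial a u =1 partial a w}.
Proof.
move=> Uo uv x /set_mem Ux; apply: near_eq_derive.
apply: filterS (open_nbhs_nbhs (conj Uo Ux)) => y Uy.
by apply: uv; rewrite inE.
Qed.

(** Agreement on an open set is agreement near each of its points, hence passes to all iterated
    partial derivatives. *)
Lemma eq_smooth_on U (u w : 'rV[R]_m -> R) : open U ->
  {in U, u =1 w} -> smooth_on U u -> smooth_on U w.
Proof.
move=> Uo uv su s x Ux.
have E : {in U, foldr (@partial R m) u s =1 foldr (@partial R m) w s}.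
  by elim: s => //= a s IH; exact: eq_partial_on.
have {}E : \forall y \near x,
    foldr (@partial R m) u s y = foldr (@partial R m) w s y.
  apply: filterS (open_nbhs_nbhs (conj Uo Ux)) => y Uy.
  by apply: E; rewrite inE.
have [cu du] := su s x Ux; split; last first.
  by move=> a; exact: near_eq_derivable (du a).
rewrite /prop_for /continuous_at -(nbhs_singleton E).
by apply: cvg_trans cu; exact: near_eq_cvg E.
Qed.

(** Iterated partial derivatives pass through a sum with constant coefficients, by induction on the
    list of directions. This is the case that a linear change of coordinates in the target needs. *)
Lemma smooth_on_lincomb U N (u : 'I_N -> 'rV[R]_m -> R) (c : 'I_N -> R) :
  open U -> (forall j, smooth_on U (u j)) ->
  smooth_on U (fun x => \sum_j u j x * c j).
Proof.
move=> Uo su s x Ux.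
have der w y a : U y -> (forall j, smooth_on U (w j)) ->
    is_derive y (delta_mx 0 a : 'rV[R]_m) (fun z => \sum_j w j z * c j)
      (\sum_j partial a (w j) y * c j).
  move=> Uy sw; apply: is_derive_eq.
    by apply: is_derive_dot => j //; exact: smooth_on_derivable (sw j) Uy.
  by apply: eq_bigr => j _; rewrite derive_cst mulr0 addr0.
have sf w t : smooth_on U w -> smooth_on U (foldr (@partial R m) w t).
  move=> sw; elim: t => [|a t IH]; first exact: sw.
  exact: (@smooth_on_partial U a _ IH).
have E t : {in U, foldr (@partial R m) (fun x => \sum_j u j x * c j) t
              =1 fun x => \sum_j foldr (@partial R m) (u j) t x * c j}.
  elim: t => //= a t IH y yU; rewrite (eq_partial_on a Uo IH yU).
  by have [_] := der (fun j => foldr (@partial R m) (u j) t) y a (set_mem yU)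
    (fun j => sf _ t (su j)).
have {}E : {near x, (fun x => \sum_j foldr (@partial R m) (u j) s x * c j)
              =1 foldr (@partial R m) (fun x => \sum_j u j x * c j) s}.
  apply: filterS (open_nbhs_nbhs (conj Uo Ux)) => y Uy.
  by rewrite E// inE.
split; last first.
  move=> a; apply: near_eq_derivable E _.
  by have [] := der (fun j => foldr (@partial R m) (u j) s) x a Ux
    (fun j => sf _ s (su j)).
rewrite /prop_for /continuous_at -(nbhs_singleton E).
apply: (@cvg_trans _
  ((fun x => \sum_j foldr (@partial R m) (u j) s x * c j) @ x)).
  exact: near_eq_cvg E.
have addC : continuous (fun z : R * R => z.1 + z.2).
  by move=> z; apply: cvgD; [exact: cvg_fst | exact: cvg_snd].
apply: (@cvg_big R 'I_N +%R 0 xpredT addC _ (nbhs x) (index_enum 'I_N)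
  (fun j y => foldr (@partial R m) (u j) s y * c j)
  (fun j => foldr (@partial R m) (u j) s x * c j) _) => j _.
by apply: cvgM; [have [] := su j s x Ux | exact: cvg_cst].
Qed.

Lemma smooth_on_partialC U (u : 'rV[R]_m -> R) a b x : open U ->
  smooth_on U u -> U x -> partial a (partial b u) x = partial b (partial a u) x.
Proof.
move=> Uo su Ux; apply: derive_comm.
- apply: filterS (open_nbhs_nbhs (conj Uo Ux)) => y Uy.
  split; first exact: smooth_on_derivable su Uy.
  - exact: smooth_on_derivable su Uy.
  - exact: smooth_on_derivable (@smooth_on_partial U b _ su) Uy.
  - exact: smooth_on_derivable (@smooth_on_partial U a _ su) Uy.
- by have [] := su [:: a; b] x Ux.
- by have [] := su [:: b; a] x Ux.
Qed.

End SmoothFunctions.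

(** * Differentiation on a manifold through a chart *)

Section ChartCalculus.
Variables (R : realType) (m : nat) (M : topologicalType) (phi : chart R m M).
Implicit Types (h : M -> R) (p : M) (a b : 'I_m).

Local Notation smooth := (smooth_in_chart phi setT).
Local Notation U := [set phi x | x in chart_dom phi].

Lemma smooth_in_chartE h : smooth h <-> smooth_on U (h \o chart_inv phi).
Proof. by rewrite /smooth_in_chart setIT. Qed.

Lemma chart_img p : chart_dom phi p -> U (phi p).
Proof. by move=> pD; exists p. Qed.

Lemma chart_invK x : U x -> phi (chart_inv phi x) = x.
Proof. by case=> p pD <-; rewrite chart_mapK. Qed.

Lemma eq_in_chart h1 h2 : {in chart_dom phi, h1 =1 h2} ->
  {in U, h1 \o chart_inv phi =1 h2 \o chart_inv phi}.
Proof.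
move=> h12 x /set_mem[p pD <-] /=; rewrite chart_mapK//.
by apply: h12; rewrite inE.
Qed.

Lemma eq_cpartial h1 h2 a p : {in chart_dom phi, h1 =1 h2} ->
  chart_dom phi p -> cpartial phi a h1 p = cpartial phi a h2 p.
Proof.
move=> /eq_in_chart h12 pD.
apply: (eq_partial_on a (@chart_img_open _ _ _ phi) h12).
by rewrite inE; exact: chart_img.
Qed.

(** On the image of the chart, [phi] undoes [chart_inv phi]; this turns iterated chart derivatives
    into iterated partial derivatives on an open set. *)
Lemma cpartialE h a :
  {in U, cpartial phi a h \o chart_inv phi =1 partial a (h \o chart_inv phi)}.
Proof. by move=> x /set_mem Ux; rewrite /cpartial /= chart_invK. Qed.

Lemma cpartial_cst (r : R) a p : cpartial phi a (fun=> r) p = 0.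
Proof. exact: derive_cst. Qed.

Lemma smooth_cpartial h a : smooth h -> smooth (cpartial phi a h).
Proof.
move=> /smooth_in_chartE/(@smooth_on_partial _ _ _ a) sh.
apply/smooth_in_chartE/(eq_smooth_on _ _ sh); first exact: chart_img_open.
by move=> x Ux; rewrite cpartialE.
Qed.

Lemma smooth_lincomb N (h : 'I_N -> M -> R) (c : 'I_N -> R) :
  (forall j, smooth (h j)) -> smooth (fun p => \sum_j h j p * c j).
Proof.
move=> sh; apply/smooth_in_chartE.
apply: (@smooth_on_lincomb _ _ _ _ (fun j => h j \o chart_inv phi)).
  exact: chart_img_open.
by move=> j; apply/smooth_in_chartE.
Qed.

Lemma derivable_chart h a p : smooth h -> chart_dom phi p ->
  derivable (h \o chart_inv phi) (phi p) (delta_mx 0 a).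
Proof.
by move=> /smooth_in_chartE sh pD; exact: smooth_on_derivable sh (chart_img pD).
Qed.

(** Derivability is kept along with the value, since the local constancy of [|f_1|^2] asks for
    both. *)
Lemma is_derive_chart_dot N (f g : 'I_N -> M -> R) a p :
  (forall s, smooth (f s)) -> (forall s, smooth (g s)) -> chart_dom phi p ->
  is_derive (phi p) (delta_mx 0 a : 'rV[R]_m)
    ((fun q => \sum_s f s q * g s q) \o chart_inv phi)
    (\sum_s (cpartial phi a (f s) p * g s p + f s p * cpartial phi a (g s) p)).
Proof.
move=> sf sg pD.
have := @is_derive_dot _ _ _ (fun s => f s \o chart_inv phi)
  (fun s => g s \o chart_inv phi) (phi p) (delta_mx 0 a)
  (fun s => @derivable_chart _ a _ (sf s) pD)
  (fun s => @derivable_chart _ a _ (sg s) pD).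
by rewrite /= chart_mapK.
Qed.

Lemma cpartial_dot N (f g : 'I_N -> M -> R) a p :
  (forall s, smooth (f s)) -> (forall s, smooth (g s)) -> chart_dom phi p ->
  cpartial phi a (fun q => \sum_s f s q * g s q) p =
  \sum_s (cpartial phi a (f s) p * g s p + f s p * cpartial phi a (g s) p).
Proof. by move=> sf sg pD; case: (@is_derive_chart_dot _ _ _ a _ sf sg pD). Qed.

Lemma cpartial_lincomb N (h : 'I_N -> M -> R) (c : 'I_N -> R) a p :
  (forall j, smooth (h j)) -> chart_dom phi p ->
  cpartial phi a (fun q => \sum_j h j q * c j) p =
  \sum_j cpartial phi a (h j) p * c j.
Proof.
move=> sh pD; have [_] := @is_derive_dot _ _ _
  (fun s => h s \o chart_inv phi) (fun s => cst (c s)) (phi p) (delta_mx 0 a)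
  (fun s => @derivable_chart _ a _ (sh s) pD) (fun=> derivable_cst _ _ _).
move=> E; apply: etrans E _.
by apply: eq_bigr => j _; rewrite derive_cst mulr0 addr0.
Qed.

Lemma cpartialC h a b p : smooth h -> chart_dom phi p ->
  cpartial phi a (cpartial phi b h) p = cpartial phi b (cpartial phi a h) p.
Proof.
move=> /smooth_in_chartE sh pD; have pU := mem_set (chart_img pD).
have Uo := @chart_img_open _ _ _ phi.
rewrite [LHS](eq_partial_on a Uo (@cpartialE h b) pU).
rewrite [RHS](eq_partial_on b Uo (@cpartialE h a) pU).
exact: smooth_on_partialC Uo sh (chart_img pD).
Qed.

(** This is [derive0_locally_cst] read in the chart; continuity of the chart map pulls the
    neighbourhood back to the manifold. *)
Lemma cpartial0_locally_cst h p :
  (forall q, chart_dom phi q -> forall a,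
     derivable (h \o chart_inv phi) (phi q) (delta_mx 0 a) /\
     cpartial phi a h q = 0) ->
  chart_dom phi p -> \forall q \near p, h q = h p.
Proof.
move=> dh pD.
have E : \forall y \near phi p,
    (h \o chart_inv phi) y = (h \o chart_inv phi) (phi p).
  apply: derive0_locally_cst (chart_img pD); first exact: chart_img_open.
  by move=> _ [q qD <-]; exact: dh.
have {}E := chart_map_continuous pD E.
have D := open_nbhs_nbhs (conj (chart_dom_open phi) pD).
apply: filterS (filterI D E) => q [qD] /=.
by rewrite !chart_mapK.
Qed.

End ChartCalculus.

(** * Inner products and positive definite matrices *)

Section DotProduct.
Variables (R : realType) (N : nat).
Implicit Types (u v w : 'rV[R]_N) (r : R).

Lemma dotE u v : dot u v = (u *m v^T) 0 0.
Proof. by rewrite mxE; apply: eq_bigr => s _; rewrite mxE. Qed.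

Lemma dotC u v : dot u v = dot v u.
Proof. by apply: eq_bigr => s _; rewrite mulrC. Qed.

Lemma dotZl r u v : dot (r *: u) v = r * dot u v.
Proof. by rewrite mulr_sumr; apply: eq_bigr => s _; rewrite mxE mulrA. Qed.

Lemma dotBl u v w : dot (u - v) w = dot u w - dot v w.
Proof. by rewrite -sumrB; apply: eq_bigr => s _; rewrite !mxE mulrBl. Qed.

Lemma dot_suml (I : finType) (u : I -> 'rV[R]_N) w :
  dot (\sum_i u i) w = \sum_i dot (u i) w.
Proof.
rewrite exchange_big; apply: eq_bigr => s _.
by rewrite summxE mulr_suml.
Qed.

Lemma dot_deltal s v : dot (delta_mx 0 s) v = v 0 s.
Proof.
rewrite /dot (bigD1 s)//= big1 ?addr0 => [|j js]; rewrite mxE eqxx/=.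
  by rewrite eqxx mul1r.
by rewrite (negbTE js) mul0r.
Qed.

Lemma dot_mulmx (Q : 'M[R]_N) u v :
  Q *m Q^T = 1%:M -> dot (u *m Q) (v *m Q) = dot u v.
Proof. by move=> QQ; rewrite !dotE trmx_mul mulmxA -(mulmxA u) QQ mulmx1. Qed.

End DotProduct.

Lemma congrmx_diagE (R : realType) (m n : nat) (G : 'M[R]_m)
    (A : 'M[R]_(m, n)) s :
  (A^T *m G *m A) s s = ((col s A)^T *m G *m col s A) 0 0.
Proof.
rewrite tr_col -row_mul [LHS]mxE [RHS]mxE.
by apply: eq_bigr => j _; rewrite [row _ _ _ _]mxE [col _ _ _ _]mxE.
Qed.

Section PositiveDefinite.
Variables (R : realType) (m : nat) (g : 'M[R]_m).
Hypothesis g_sym : g^T = g.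
Hypothesis g_pos : forall v : 'rV[R]_m, v != 0 -> 0 < (v *m g *m v^T) 0 0.

Lemma posdef_unitmx : g \in unitmx.
Proof.
rewrite -row_free_unit -kermx_eq0; apply/rowV0P => v /sub_kermxP vg.
by apply/eqP/negP => /negP /g_pos; rewrite vg mul0mx mxE ltxx.
Qed.

(** By symmetry of [g], the value at [v] is that of the form [g] at [w = v g^-1]. *)
Lemma invmx_posdef (v : 'rV[R]_m) : v != 0 ->
  0 < (v *m invmx g *m v^T) 0 0.
Proof.
move=> v0; have gU := posdef_unitmx; pose w := v *m invmx g.
have vE : v = w *m g by rewrite mulmxKV.
have w0 : w != 0 by apply: contraNneq v0 => w0; rewrite vE w0 mul0mx.
by have := g_pos w0; rewrite -vE trmx_mul trmx_inv g_sym mulmxA.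
Qed.

(** The trace is the sum of the squared [g^-1]-norms of the columns of [A]. Applied to the
    differential of [f_1], it handles the points where [lambda] vanishes. *)
Lemma mxtrace_invmx_eq0 n (A : 'M[R]_(m, n)) :
  \tr (A^T *m invmx g *m A) = 0 -> A = 0.
Proof.
move=> tr0; apply/trmx_inj/row_matrixP => s; rewrite trmx0 row0 -tr_col.
apply/eqP/negP => /negP As.
have X0 t : 0 <= (A^T *m invmx g *m A) t t.
  rewrite congrmx_diagE -[X in _ *m X]trmxK.
  have [->|At] := eqVneq (col t A)^T 0; last exact/ltW/invmx_posdef.
  by rewrite !mul0mx mxE.
have /(_ s isT) Xs := psumr_eq0P (fun t _ => X0 t) tr0.
by have := invmx_posdef As; rewrite trmxK -congrmx_diagE Xs ltxx.
Qed.

End PositiveDefinite.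

(** * Isometric immersions into Euclidean space and their Laplacian *)

Section IsometricImmersion.
Variables (R : realType) (m N : nat) (M : riemannianManifold R m).
Variable f : M -> 'rV[R]_N.
Hypothesis f_isom : isometric_immersion f.
Implicit Types (i : chart_index M) (p : M) (a b d e : 'I_m).

Lemma smooth_comp i s : smooth_in_chart (atlas i) setT (fun p => f p 0 s).
Proof. exact: f_isom.1. Qed.

Lemma tangent_map_delta i p a : tangent_map f i p (delta_mx 0 a) =
  vpartial f i a p.
Proof.
rewrite /tangent_map (bigD1 a)//= big1 ?addr0 => [|b ba]; rewrite mxE eqxx/=.
  by rewrite eqxx scale1r.
by rewrite (negbTE ba) scale0r.
Qed.

Lemma metricE i p a b : chart_dom (atlas i) p ->
  metric i p a b = dot (vpartial f i a p) (vpartial f i b p).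
Proof.
move=> pD; rewrite -!tangent_map_delta (f_isom.2 _ _ pD) -rowE.
by rewrite trmx_delta -colE !mxE.
Qed.

(** By isometry the metric is the Gram matrix of the coordinate vectors, to which the product rule
    applies. *)
Lemma cpartial_metric i a b d p : chart_dom (atlas i) p ->
  cpartial (atlas i) a (fun q => metric i q b d) p =
  dot (vpartial2 f i a b p) (vpartial f i d p)
  + dot (vpartial2 f i a d p) (vpartial f i b p).
Proof.
move=> pD.
pose df e s := cpartial (atlas i) e (fun q => f q 0 s).
have sdf e s : smooth_in_chart (atlas i) setT (df e s).
  exact: smooth_cpartial (@smooth_comp i s).
rewrite (@eq_cpartial _ _ _ _ _ (fun q => \sum_s df b s q * df d s q))//.
  rewrite cpartial_dot// big_split; congr (_ + _);
    apply: eq_bigr => s _; rewrite [in RHS]mxE [vpartial _ _ _ _ _ _]mxE//.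
  exact: mulrC.
move=> q /set_mem qD; rewrite metricE//.
by apply: eq_bigr => s _; rewrite !mxE.
Qed.

Lemma vpartial2C i a b p : chart_dom (atlas i) p ->
  vpartial2 f i a b p = vpartial2 f i b a p.
Proof.
move=> pD; apply/rowP => s; rewrite [LHS]mxE [RHS]mxE.
exact: cpartialC (@smooth_comp i s) pD.
Qed.

Lemma metric_unitmx i p : chart_dom (atlas i) p -> metric i p \in unitmx.
Proof. by move=> pD; apply: posdef_unitmx; exact: metric_posdef pD. Qed.

(* Koszul's formula: the tangential part of the flat derivative is the
   Levi-Civita connection. *)
Lemma dot_vpartial2 i a b d p : chart_dom (atlas i) p ->
  dot (vpartial2 f i a b p) (vpartial f i d p) =
  \sum_e christoffel i e a b p * dot (vpartial f i e p) (vpartial f i d p).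
Proof.
move=> pD.
(* [x] holds the covariant components of the tangential part of the second derivative; raising the
   index gives the Christoffel symbols. *)
pose x : 'rV[R]_m :=
  \row_e dot (vpartial2 f i a b p) (vpartial f i e p).
have G e : christoffel i e a b p = (x *m invmx (metric i p)) 0 e.
  rewrite /christoffel mulr_sumr mxE; apply: eq_bigr => j _.
  have -> : inv_metric i p e j = invmx (metric i p) j e.
    rewrite /inv_metric -[in RHS](Defs.metric_sym pD) -trmx_inv mxE //.
  (* Once the second derivatives are symmetrized, two pairs of the six terms cancel, and the other
     two are equal and absorb the factor 1/2. *)
  rewrite !cpartial_metric// mxE (vpartial2C j a pD) (vpartial2C j b pD).
  rewrite (vpartial2C b a pD).
  rewrite mulrCA [RHS]mulrC; congr (_ * _).
  generalize (dot (vpartial2 f i a b p) (vpartial f i j p))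
    (dot (vpartial2 f i a j p) (vpartial f i b p))
    (dot (vpartial2 f i b j p) (vpartial f i a p)) => X Y Z.
  by field.
transitivity ((x *m invmx (metric i p) *m metric i p) 0 d).
  by rewrite mulmxKV ?mxE// metric_unitmx.
by rewrite mxE; apply: eq_bigr => e _; rewrite G metricE.
Qed.

Lemma vlaplacianE i p : vlaplacian f i p =
  \sum_a \sum_b inv_metric i p a b *:
    (vpartial2 f i a b p - \sum_e christoffel i e a b p *: vpartial f i e p).
Proof.
apply/rowP => s; rewrite summxE mxE; apply: eq_bigr => a _.
rewrite summxE; apply: eq_bigr => b _; rewrite !mxE summxE.
by congr (_ * (_ - _)); apply: eq_bigr => e _; rewrite !mxE.
Qed.

(** Orthogonality holds before taking the trace: by [dot_vpartial2] every entry of the vector-valued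
    Hessian is normal to [f]. *)
Lemma vlaplacian_normal i p d : chart_dom (atlas i) p ->
  dot (vlaplacian f i p) (vpartial f i d p) = 0.
Proof.
move=> pD; rewrite vlaplacianE dot_suml big1// => a _.
rewrite dot_suml big1// => b _; rewrite dotZl dotBl dot_suml dot_vpartial2//.
under [X in _ - X]eq_bigr do rewrite dotZl.
by rewrite subrr mulr0.
Qed.

End IsometricImmersion.

Lemma dot_split (R : realType) (n k : nat) (u v : 'rV[R]_(n + k)) :
  dot u v = dot (lsubmx u) (lsubmx v) + dot (rsubmx u) (rsubmx v).
Proof.
by rewrite /dot big_split_ord; congr (_ + _);
  apply: eq_bigr => s _; rewrite !mxE.
Qed.

Lemma dot_row_mx0 (R : realType) (n k : nat) (u : 'rV[R]_n)
    (v : 'rV[R]_(n + k)) :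
  dot (row_mx u 0) v = dot u (lsubmx v).
Proof.
rewrite dot_split row_mxKl row_mxKr [X in _ + X]big1 ?addr0// => s _.
by rewrite mxE mul0r.
Qed.

Lemma gram_mxE (R : realType) (m N : nat) (u : 'I_m -> 'rV[R]_N) a b :
  (\matrix_a u a *m (\matrix_a u a)^T) a b = dot (u a) (u b).
Proof. by rewrite mxE; apply: eq_bigr => s _; rewrite !mxE. Qed.

(** * The theorem in the coordinates of the frame *)

Section AdaptedCoordinates.
Variables (R : realType) (m n k : nat) (M : riemannianManifold R m).
Variables (f : M -> 'rV[R]_(n.+1 + k)) (T : 'I_k -> vectorField M) (c : R).
Hypothesis f_isom : isometric_immersion f.
Hypothesis T_proj : forall j : 'I_k,
  is_tangent_projection f (delta_mx 0 (rshift n.+1 j)) (T j).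
Hypothesis c_neq0 : c != 0.

Let lambda i p : R := m%:R - \sum_(j < k) field_normsq (T j) i p.

Hypothesis f_laplacian : forall i p, chart_dom (atlas i) p ->
  vlaplacian f i p = (- c * lambda i p) *: row_mx (lsubmx (f p)) 0.
Hypothesis nondegenerate : forall p : M, exists q i,
  [/\ connected_component [set: M] p q, chart_dom (atlas i) q
    & lambda i q != 0].

Implicit Types (i : chart_index M) (p q : M) (a b d : 'I_m).

(** [A] and [B] are the transposed Jacobian matrices of [f_1] and [f_2] in the chart. *)
Let A i p : 'M[R]_(m, n.+1) := \matrix_a lsubmx (vpartial f i a p).
Let B i p : 'M[R]_(m, k) := \matrix_a rsubmx (vpartial f i a p).

Let metric_split i p : chart_dom (atlas i) p ->
  metric i p = A i p *m (A i p)^T + B i p *m (B i p)^T.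
Proof.
move=> pD; apply/matrixP => a b; rewrite (metricE f_isom)// dot_split.
by rewrite [RHS]mxE !gram_mxE.
Qed.

(** Testing the projection against the coordinate vectors shows that [T j] is the gradient of the
    [j]-th component of [f_2]. *)
Let T_metric i p j : chart_dom (atlas i) p ->
  T j i p *m metric i p = (col j (B i p))^T.
Proof.
move=> pD; apply/rowP => b.
have := T_proj j pD (delta_mx 0 b).
rewrite dotBl (f_isom.2 _ _ pD) (tangent_map_delta f) dot_deltal.
move/subr0_eq; rewrite trmx_delta -colE [col _ _ _ _]mxE => <-.
by rewrite [RHS]mxE [RHS]mxE [RHS]mxE [RHS]mxE.
Qed.

(** Write [m] as the trace of [g^-1 g] and split [g = A A^T + B B^T]. By [T_metric] the squared
    norms of the [T j] add up to the trace of [B^T g^-1 B], which cancels the second part. *)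
Let lambdaE i p : chart_dom (atlas i) p ->
  lambda i p = \tr ((A i p)^T *m invmx (metric i p) *m A i p).
Proof.
move=> pD; have gU := metric_unitmx pD; rewrite /lambda.
have -> : m%:R = \tr (invmx (metric i p) *m metric i p) :> R.
  by rewrite mulVmx// mxtrace1.
have -> : \sum_(j < k) field_normsq (T j) i p
        = \tr ((B i p)^T *m invmx (metric i p) *m B i p).
  apply: eq_bigr => j _; rewrite congrmx_diagE /field_normsq T_metric//.
  rewrite -[X in _ *m X^T](mulmxK gU) T_metric// trmx_mul trmx_inv trmxK.
  by rewrite Defs.metric_sym// mulmxA.
rewrite {2}metric_split// mulmxDr mxtraceD !mulmxA.
rewrite (mxtrace_mulC _ (A i p)^T) (mxtrace_mulC _ (B i p)^T) !mulmxA.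
by rewrite addrK.
Qed.

Let sum_inv_metric i p : chart_dom (atlas i) p ->
  \sum_a \sum_b inv_metric i p a b *
    dot (lsubmx (vpartial f i a p)) (lsubmx (vpartial f i b p)) = lambda i p.
Proof.
move=> pD; rewrite lambdaE// -mulmxA mxtrace_mulC.
rewrite -mulmxA; apply: eq_bigr => a _.
rewrite [RHS]mxE; apply: eq_bigr => b _.
by rewrite gram_mxE dotC.
Qed.

Let radial_normal i p a : chart_dom (atlas i) p ->
  dot (lsubmx (f p)) (lsubmx (vpartial f i a p)) = 0.
Proof.
move=> pD; have := vlaplacian_normal f_isom a pD.
rewrite f_laplacian// dotZl dot_row_mx0 => /eqP.
rewrite !mulf_eq0 oppr_eq0 (negbTE c_neq0)/= => /orP[/eqP l0|/eqP//].
(* Here [lambda] vanishes at [p], so the differential of [f_1] vanishes there as well. *)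
have A0 : A i p = 0.
  apply: (mxtrace_invmx_eq0 (Defs.metric_sym pD) (metric_posdef pD)).
  by rewrite -lambdaE.
have -> : lsubmx (vpartial f i a p) = 0.
  rewrite -(rowK (fun b => lsubmx (vpartial f i b p))).
  by rewrite -/(A i p) A0 row0.
by rewrite dotC -(scale0r (0 : 'rV[R]_n.+1)) dotZl mul0r.
Qed.

Let lf s p : R := f p 0 (lshift k s).

Let smooth_lf i s : smooth_in_chart (atlas i) setT (lf s).
Proof. exact: f_isom.1. Qed.

Let normsq_lf p : dot (lsubmx (f p)) (lsubmx (f p)) = \sum_s lf s p * lf s p.
Proof. by apply: eq_bigr => s _; rewrite !mxE. Qed.

Let radial_normal_lf i p b : chart_dom (atlas i) p ->
  \sum_s lf s p * cpartial (atlas i) b (lf s) p = 0.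
Proof.
move=> pD; rewrite -[RHS](radial_normal b pD).
by apply: eq_bigr => s _; rewrite [lsubmx (f p) _ _]mxE [lsubmx _ _ _]mxE mxE.
Qed.

(** Both halves of the product rule for [|f_1|^2] vanish by [radial_normal_lf]. *)
Let normsq_component p q : connected_component [set: M] p q ->
  dot (lsubmx (f q)) (lsubmx (f q)) = dot (lsubmx (f p)) (lsubmx (f p)).
Proof.
rewrite !normsq_lf; apply: (@locally_cst_component M R
  (fun p => \sum_s lf s p * lf s p)) => {q}p.
have [i pD] := atlas_cover p.
apply: cpartial0_locally_cst pD => q qD a.
have [dh E] := @is_derive_chart_dot _ _ _ _ _ lf lf a q
  (@smooth_lf i) (@smooth_lf i) qD.
split=> //; apply: etrans E _; rewrite big_split /=.
under eq_bigr do rewrite mulrC.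
by rewrite radial_normal_lf// addr0.
Qed.

(** The relation [radial_normal_lf] holds on the whole chart domain, so it can be differentiated in
    direction [a]. *)
Let dot_lf_vpartial2 i p a b : chart_dom (atlas i) p ->
  dot (lsubmx (f p)) (lsubmx (vpartial2 f i a b p)) =
  - dot (lsubmx (vpartial f i a p)) (lsubmx (vpartial f i b p)).
Proof.
move=> pD; apply/eqP; rewrite -addr_eq0; apply/eqP.
have := @eq_cpartial _ _ _ (atlas i)
  (fun q => \sum_s lf s q * cpartial (atlas i) b (lf s) q) (fun=> 0) a p.
rewrite cpartial_cst cpartial_dot//; last first.
  by move=> s; exact: smooth_cpartial (@smooth_lf i s).
move=> /(_ _ pD) <-; last by move=> q /set_mem qD; exact: radial_normal_lf.
rewrite big_split addrC /=; congr (_ + _); apply: eq_bigr => s _.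
  by rewrite [lsubmx _ _ _]mxE [vpartial _ _ _ _ _ _]mxE [lsubmx _ _ _]mxE
    [vpartial _ _ _ _ _ _]mxE.
by rewrite [lsubmx _ _ _]mxE [lsubmx _ _ _]mxE [vpartial2 _ _ _ _ _ _ _]mxE.
Qed.

Let sum_inv_metric2 i p : chart_dom (atlas i) p ->
  \sum_a \sum_b inv_metric i p a b *
    dot (lsubmx (f p)) (lsubmx (vpartial2 f i a b p)) = - lambda i p.
Proof.
move=> pD; rewrite -sum_inv_metric// -sumrN; apply: eq_bigr => a _.
by rewrite -sumrN; apply: eq_bigr => b _; rewrite dot_lf_vpartial2// mulrN.
Qed.

Let normsq_lfE p : dot (lsubmx (f p)) (lsubmx (f p)) = c^-1.
Proof.
have [q [i [pq qD lq]]] := nondegenerate p.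
rewrite -(normsq_component pq).
(* In the pairing with [(f_1, 0)] the Christoffel terms drop out by [radial_normal]. *)
have : dot (row_mx (lsubmx (f q)) 0) (vlaplacian f i q) = - lambda i q.
  rewrite dotC vlaplacianE dot_suml -sum_inv_metric2//; apply: eq_bigr => a _.
  rewrite dot_suml; apply: eq_bigr => b _.
  rewrite dotZl dotBl dot_suml big1 ?subr0 => [|e _].
    by rewrite dotC dot_row_mx0.
  by rewrite dotZl dotC dot_row_mx0 radial_normal// mulr0.
rewrite f_laplacian// dotC dotZl dot_row_mx0 row_mxKl mulNr mulNr.
(* The hypothesis on the Laplacian gives [c lambda |f_1|^2 = lambda], and [lambda] is nonzero at
   [q]. *)
move/oppr_inj/eqP; rewrite -mulrA mulrCA -subr_eq0.
rewrite -{2}[lambda i q]mulr1 -mulrBr mulf_eq0 (negbTE lq)/= subr_eq0 => /eqP cE.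
by apply: (mulfI c_neq0); rewrite cE mulfV.
Qed.

Lemma adapted_sphere_prod p : sphere_prod c (f p).
Proof. exact: normsq_lfE. Qed.

(** The trace of the second fundamental form is the Laplacian minus its radial part, and by
    [sum_inv_metric2] that radial part is all of it. *)
Lemma adapted_mean_curvature i p : chart_dom (atlas i) p ->
  mean_curvature c f i p = 0.
Proof.
move=> pD; rewrite /mean_curvature.
suff -> : \sum_a \sum_b
          inv_metric i p a b *: second_fundamental_form c f i a b p
        = vlaplacian f i p - (c * \sum_a \sum_b inv_metric i p a b *
            dot (lsubmx (f p)) (lsubmx (vpartial2 f i a b p)))
            *: row_mx (lsubmx (f p)) 0.
  by rewrite sum_inv_metric2// f_laplacian// mulNr mulrN subrr scaler0.
rewrite vlaplacianE mulr_sumr scaler_suml -sumrB; apply: eq_bigr => a _.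
rewrite mulr_sumr scaler_suml -sumrB; apply: eq_bigr => b _.
rewrite /second_fundamental_form /sphere_prod_proj.
by rewrite addrAC scalerBr scalerA mulrCA.
Qed.

(** At any point of the nonempty [M], the number [c^-1] is a sum of squares. *)
Lemma adapted_curvature_gt0 : 0 < c.
Proof.
have [p _] := manifold_nonempty M.
rewrite -invr_gt0 -(normsq_lfE p) lt0r normsq_lfE invr_eq0 c_neq0/=.
by rewrite -(normsq_lfE p) sumr_ge0// => s _; rewrite -expr2 sqr_ge0.
Qed.

End AdaptedCoordinates.

(** * Behaviour under a linear change of coordinates in the target *)

Section LinearChange.
Variables (R : realType) (m N : nat) (M : riemannianManifold R m).
Variables (F : M -> 'rV[R]_N) (Q : 'M[R]_N).
Hypothesis F_smooth : forall i s,
  smooth_in_chart (atlas i) setT (fun p => F p 0 s).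
Implicit Types (i : chart_index M) (p : M) (a b : 'I_m).

Let f p := F p *m Q.

Let fE s : (fun p => f p 0 s) = (fun p => \sum_t F p 0 t * Q t s).
Proof. by apply/funext => p; rewrite mxE. Qed.

Lemma smooth_mulmx i s : smooth_in_chart (atlas i) setT (fun p => f p 0 s).
Proof.
rewrite fE; apply: (@smooth_lincomb _ _ _ _ _ (fun t p => F p 0 t)) => t.
exact: F_smooth.
Qed.

Lemma vpartial_mulmx i a p : chart_dom (atlas i) p ->
  vpartial f i a p = vpartial F i a p *m Q.
Proof.
move=> pD; apply/rowP => s; rewrite [LHS]mxE fE.
rewrite (@cpartial_lincomb _ _ _ _ _ (fun t p => F p 0 t)) => [|t|//].
  by rewrite [RHS]mxE; apply: eq_bigr => t _; rewrite [in RHS]mxE.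
exact: F_smooth.
Qed.

Lemma vpartial2_mulmx i a b p : chart_dom (atlas i) p ->
  vpartial2 f i a b p = vpartial2 F i a b p *m Q.
Proof.
move=> pD; apply/rowP => s; rewrite [LHS]mxE fE.
rewrite (@eq_cpartial _ _ _ _ _
  (fun q => \sum_t cpartial (atlas i) b (fun q => F q 0 t) q * Q t s))//.
  rewrite (@cpartial_lincomb _ _ _ _ _
    (fun t => cpartial (atlas i) b (fun q => F q 0 t))) => [|t|//].
    by rewrite [RHS]mxE; apply: eq_bigr => t _; rewrite [in RHS]mxE.
  exact: smooth_cpartial (@F_smooth i t).
move=> q /set_mem qD.
rewrite (@cpartial_lincomb _ _ _ _ _ (fun t p => F p 0 t)) => [//|t|//].
exact: F_smooth.
Qed.

Lemma tangent_map_mulmx i p v : chart_dom (atlas i) p ->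
  tangent_map f i p v = tangent_map F i p v *m Q.
Proof.
move=> pD; rewrite [RHS]mulmx_suml; apply: eq_bigr => a _.
by rewrite vpartial_mulmx// scalemxAl.
Qed.

(** The inverse metric and the Christoffel symbols belong to [M], so [Q] acts on the derivatives of
    the map alone. *)
Lemma vlaplacian_mulmx i p : chart_dom (atlas i) p ->
  vlaplacian f i p = vlaplacian F i p *m Q.
Proof.
move=> pD; rewrite !vlaplacianE mulmx_suml; apply: eq_bigr => a _.
rewrite mulmx_suml; apply: eq_bigr => b _; rewrite -scalemxAl mulmxBl.
rewrite vpartial2_mulmx// mulmx_suml; congr (_ *: (_ - _)).
by apply: eq_bigr => e _; rewrite vpartial_mulmx// scalemxAl.
Qed.

Hypothesis QQ : Q *m Q^T = 1%:M.

Lemma isometric_immersion_mulmx :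
  isometric_immersion F -> isometric_immersion f.
Proof.
move=> [_ Fi]; split=> [|i p pD v w]; first exact: smooth_mulmx.
by rewrite !tangent_map_mulmx// dot_mulmx// Fi.
Qed.

Lemma is_tangent_projection_mulmx V (T : vectorField M) :
  is_tangent_projection F V T -> is_tangent_projection f (V *m Q) T.
Proof.
move=> FT i p pD w.
by rewrite !tangent_map_mulmx// -mulmxBl dot_mulmx// FT.
Qed.

End LinearChange.

(* The last hypothesis: the factor m - sum_j ||T_j||^2 vanishes identically on
   no connected component of M.  Without it the equation holds for every c as
   soon as F is a minimal immersion into a slice {x} x R^k. *)
Theorem theorem4 (R : realType) (m n k : nat) (M : riemannianManifold R m)
    (F : M -> 'rV[R]_(n.+1 + k)) (E : 'I_(n.+1 + k) -> 'rV[R]_(n.+1 + k))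
    (T : 'I_k -> vectorField M) (c : R)
    (F_isom : isometric_immersion F)
    (E_orthonormal : orthonormal_frame E)
    (T_proj : forall j : 'I_k, is_tangent_projection F (E (rshift n.+1 j)) (T j))
    (c_neq0 : c != 0)
    (F_laplacian : forall (i : chart_index M) (p : M), chart_dom (atlas i) p ->
       vlaplacian F i p =
         (- c * (m%:R - \sum_(j < k) field_normsq (T j) i p)) *:
         (F p - \sum_(j < k) dot (F p) (E (rshift n.+1 j)) *: E (rshift n.+1 j)))
    (nondegenerate : forall p : M, exists (q : M) (i : chart_index M),
       [/\ connected_component [set: M] p q, chart_dom (atlas i) q
         & m%:R - \sum_(j < k) field_normsq (T j) i q != 0]) :
  0 < c /\
  exists f : M -> 'rV[R]_(n.+1 + k),
    minimal_isometric_immersion c f /\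
    forall p : M, F p = frame_embedding E (f p).
Proof.
(* The rows of [P] are the frame, so multiplication by [P^T] passes to coordinates in the frame. *)
pose P : 'M[R]_(n.+1 + k) := \matrix_s E s.
have PP : P *m P^T = 1%:M.
  by apply/matrixP => s t; rewrite gram_mxE E_orthonormal mxE.
have QQ : P^T *m P^T^T = 1%:M by rewrite trmxK; exact: mulmx1C.
have EP s : E s *m P^T = delta_mx 0 s.
  by rewrite -[E s](rowK E) -/P -row_mul PP row1.
pose f p := F p *m P^T.
have f_isom : isometric_immersion f.
  exact: isometric_immersion_mulmx F_isom.1 QQ F_isom.
have f_proj j : is_tangent_projection f (delta_mx 0 (rshift n.+1 j)) (T j).
  rewrite -EP; exact: is_tangent_projection_mulmx F_isom.1 QQ _ _ (T_proj j).
have f_coord p s : f p 0 s = dot (F p) (E s).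
  by rewrite mxE; apply: eq_bigr => t _; rewrite !mxE.
have f_lap i p : chart_dom (atlas i) p -> vlaplacian f i p =
    (- c * (m%:R - \sum_(j < k) field_normsq (T j) i p))
    *: row_mx (lsubmx (f p)) 0.
  move=> pD; rewrite (vlaplacian_mulmx _ F_isom.1)// F_laplacian// -scalemxAl.
  (* In frame coordinates the subtracted sum removes exactly the last [k] entries of [f p]. *)
  congr (_ *: _); rewrite mulmxBl mulmx_suml -/(f p).
  under eq_bigr do rewrite -scalemxAl EP.
  apply/rowP => s; rewrite [LHS]mxE [X in _ + X]mxE summxE [RHS]mxE.
  under eq_bigr do rewrite !mxE eqxx/=.
  case: split_ordP => t ->.
    rewrite big1 ?subr0 => [|j _]; first by rewrite !mxE.
    by rewrite eq_lrshift mulr0.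
  rewrite (bigD1 t)//= eqxx mulr1 f_coord big1 ?addr0 ?subrr ?mxE// => j jt.
  by rewrite eq_rshift eq_sym (negbTE jt) mulr0.
have c_gt0 := adapted_curvature_gt0 f_isom f_proj c_neq0 f_lap nondegenerate.
split=> //; exists f; split.
  split=> // [p|i p pD].
    exact: adapted_sphere_prod f_isom f_proj c_neq0 f_lap nondegenerate p.
  exact (adapted_mean_curvature f_isom f_proj c_neq0 f_lap pD).
(* Since [P^T P = 1], [F p] is [f p *m P], a combination of the rows of [P]. *)
move=> p; rewrite /frame_embedding -[LHS]mulmx1 -(mulmx1C PP) mulmxA -/(f p).
by rewrite mulmx_sum_row; apply: eq_bigr => s _; rewrite rowK.
Qed.
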